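(* Let $n\ge1$ and let $\mathbb{F}$ be any field. Then $\mathrm{Der}_{\mathrm{inn}}(\mathbb{F}(SD_{8n}))$ has dimension $3(2n-1)$ over $\mathbb{F}$ if $n$ is even and $6(n-1)$ if $n$ is odd. Moreover: (i) if $n$ is even, an $\mathbb{F}$-basis is $\{d_g\mid g\in\{a^{2k}\mid1\le k\le n-1\}\cup\{a^{2k+1}\mid -\frac n2\le k\le\frac n2-1\}\cup\{a^{2k}b,\ a^{2k-1}b\mid 1\le k\le 2n-1\}\}$; (ii) if $n$ is odd, an $\mathbb{F}$-basis is $\{d_g\mid g\in\{a^{2k}\mid1\le k\le n-1\}\cup\{a^{2k+1}\mid -\frac{n-1}2\le k\le\frac{n-1}2-1\}\cup\{a^{4k}b,\ a^{4k+1}b,\ a^{4k+2}b,\ a^{4k+3}b\mid 1\le k\le n-1\}\}$.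
   Context: $SD_{8n}=\langle a,b\mid a^{4n}=b^2=1,\ bab=a^{2n-1}\rangle$ is the semi-dihedral group of order $8n$ (exponents of $a$ modulo $4n$); $\mathbb{F}(SD_{8n})$ is its group algebra. For $\beta$ in the group algebra, the inner derivation $d_\beta$ is $d_\beta(\alpha)=\alpha\beta-\beta\alpha$; $\mathrm{Der}_{\mathrm{inn}}(\mathbb{F}(SD_{8n}))=\{d_\beta\}$, an $\mathbb{F}$-vector space. *)

(* Defs.v *)
From mathcomp Require Import all_boot all_order all_algebra.
Set Implicit Arguments. Unset Strict Implicit. Unset Printing Implicit Defensive.
Import GRing.Theory.
Local Open Scope ring_scope.

(* Semi-dihedral group SD_{8n} = <a,b | a^{4n}=b^2=1, bab = a^{2n-1}>.
   The element a^i b^e is encoded as the pair (i mod 4n, e).  (Used with n >= 1,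
   so that 'Z_(4n) really is Z/4nZ.) *)
Definition SD (n : nat) : finType := ('Z_(4 * n) * bool)%type.

(* a^i b^e * a^j b^f = a^(i + j (2n-1)^e) b^(e+f), since b a^j = a^(j(2n-1)) b. *)
Definition sdmul (n : nat) (x y : SD n) : SD n :=
  (x.1 + (if x.2 then y.1 * (2 * n - 1)%:R else y.1), x.2 (+) y.2).

Definition sda (n : nat) (k : int) : SD n := (k%:~R, false).
Definition sdab (n : nat) (k : int) : SD n := (k%:~R, true).

Definition GA (F : fieldType) (n : nat) := {ffun SD n -> F^o}.

Definition gamul (F : fieldType) (n : nat) (al be : GA F n) : GA F n :=
  [ffun x => \sum_(y : SD n) \sum_(z : SD n)
               (if sdmul y z == x then al y * be z else 0)].

Definition gael (F : fieldType) (n : nat) (g : SD n) : GA F n :=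
  [ffun x => (x == g)%:R].

Definition innder (F : fieldType) (n : nat) (be : GA F n) (al : GA F n) : GA F n :=
  gamul al be - gamul be al.

Definition dinn (F : fieldType) (n : nat) (be : GA F n) : 'End(GA F n) :=
  linfun (innder be).

Definition DerInn (F : fieldType) (n : nat) : {vspace 'End(GA F n)} :=
  limg (linfun (@dinn F n) : 'Hom(GA F n, 'End(GA F n))).

Definition basis_even (n : nat) : seq (SD n) :=
  [seq sda n (2 * k%:Z) | k <- iota 1 (n - 1)] ++
  [seq sda n (2 * (i%:Z - (n./2)%:Z) + 1) | i <- iota 0 n] ++
  flatten [seq [:: sdab n (2 * k%:Z); sdab n (2 * k%:Z - 1)] | k <- iota 1 (2 * n - 1)].

Definition basis_odd (n : nat) : seq (SD n) :=
  [seq sda n (2 * k%:Z) | k <- iota 1 (n - 1)] ++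
  [seq sda n (2 * (i%:Z - ((n - 1)./2)%:Z) + 1) | i <- iota 0 (n - 1)] ++
  flatten [seq [:: sdab n (4 * k%:Z); sdab n (4 * k%:Z + 1);
                   sdab n (4 * k%:Z + 2); sdab n (4 * k%:Z + 3)] | k <- iota 1 (n - 1)].

(* Main.v *)
Require Import Defs.
From HB Require Import structures.
From mathcomp Require Import all_boot all_order all_algebra.
From mathcomp Require Import zify ring.

(* The kernel of beta |-> d_beta is the center, which consists of the functions that
   are constant on conjugacy classes.  Hence, for every set S of group elements
   that omits exactly one element of each class, the d_g with g in S form a
   basis: subtracting from a function its value at the omitted element of each
   class gives a function supported on S with the same inner derivation, and a
   central function supported on S vanishes.  The listed sets have this property:
   the classes are the pairs {a^i, a^(i(2n-1))} together with the sets of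
   a^i b with i in a fixed class modulo 2 (n even) or modulo 4 (n odd). *)

Set Implicit Arguments. Unset Strict Implicit. Unset Printing Implicit Defensive.
Import GRing.Theory.
Local Open Scope ring_scope.

(** * The group law of the semi-dihedral group *)

Section SemiDihedral.

Variables (n : nat) (n_gt0 : (0 < n)%N).
Implicit Types (x y z g : SD n) (i : 'Z_(4 * n)).

Lemma four_n_eq0 : 4 * n%:R = 0 :> 'Z_(4 * n).
Proof. by rewrite -natrM pchar_Zp //; lia. Qed.

Lemma sdexpE : (2 * n - 1)%:R = 2 * n%:R - 1 :> 'Z_(4 * n).
Proof. by rewrite natrB ?natrM //; lia. Qed.

Lemma sdmulA : associative (@sdmul n).
Proof.
move=> [i e] [j f] [k h]; rewrite /sdmul /= addbA sdexpE; congr (_, _).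
have n4 := four_n_eq0.
case: e; case: f => /=; try ring.
(* For two reflections the sides differ by the factor (2n-1)^2 = 1 + 4n(n-1) on [k], which is 1
   modulo 4n. *)
have -> : i + j * (2 * n%:R - 1) + k = i + j * (2 * n%:R - 1) + k + 4 * n%:R * ((n%:R - 1) * k).
  by rewrite n4 mul0r addr0.
by ring.
Qed.

Definition sdinv x : SD n := (if x.2 then - x.1 * (2 * n - 1)%:R else - x.1, x.2).

Lemma sdmul1g x : sdmul (0, false) x = x.
Proof. by case: x => i e; rewrite /sdmul /= add0r. Qed.

Lemma sdmulg1 x : sdmul x (0, false) = x.
Proof. by case: x => i [] ; rewrite /sdmul /= ?mul0r addr0. Qed.

Lemma sdmulgV x : sdmul x (sdinv x) = (0, false).
Proof.
case: x => i []; rewrite /sdmul /sdinv /= ?subrr //; congr (_, _).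
transitivity (4 * n%:R * ((1 - n%:R) * i)); first by rewrite sdexpE; ring.
by rewrite four_n_eq0 mul0r.
Qed.

Lemma sdmulVg x : sdmul (sdinv x) x = (0, false).
Proof. by case: x => i []; rewrite /sdmul /sdinv /= ?mulNr ?addNr //. Qed.

Lemma sdmul_eqr x y z : (sdmul y z == x) = (y == sdmul x (sdinv z)).
Proof.
apply/eqP/eqP => [<-|->]; first by rewrite -sdmulA sdmulgV sdmulg1.
by rewrite -sdmulA sdmulVg sdmulg1.
Qed.

Lemma sdmul_eql x y z : (sdmul z y == x) = (y == sdmul (sdinv z) x).
Proof.
apply/eqP/eqP => [<-|->]; first by rewrite sdmulA sdmulVg sdmul1g.
by rewrite sdmulA sdmulgV sdmul1g.
Qed.

(** * The group algebra and its inner derivations *)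

Variable F : fieldType.
Implicit Types (al be : GA F n).

Lemma gamulEl al be x : gamul al be x = \sum_z al (sdmul x (sdinv z)) * be z.
Proof.
rewrite ffunE exchange_big; apply: eq_bigr => z _ /=.
rewrite (bigD1 (sdmul x (sdinv z))) //= sdmul_eqr eqxx big1 ?addr0 // => y.
by rewrite sdmul_eqr => /negPf->.
Qed.

Lemma gamulEr al be x : gamul al be x = \sum_z al z * be (sdmul (sdinv z) x).
Proof.
rewrite ffunE; apply: eq_bigr => z _ /=.
rewrite (bigD1 (sdmul (sdinv z) x)) //= sdmul_eql eqxx big1 ?addr0 // => y.
by rewrite sdmul_eql => /negPf->.
Qed.

Lemma gamul_linearl be : linear ((@gamul F n)^~ be).
Proof.
move=> c al al'; apply/ffunP => x /=; rewrite [RHS]ffunE [X in _ = X + _]ffunE !gamulEl.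
rewrite scaler_sumr -big_split /=.
apply: eq_bigr => z _.
by rewrite !ffunE mulrDl /GRing.scale /= mulrA.
Qed.

Lemma gamul_linearr al : linear (@gamul F n al).
Proof.
move=> c be be'; apply/ffunP => x /=; rewrite [RHS]ffunE [X in _ = X + _]ffunE !gamulEl.
rewrite scaler_sumr -big_split /=; apply: eq_bigr => z _.
by rewrite !ffunE mulrDr /GRing.scale /= mulrCA.
Qed.

Lemma innder_linear be : linear (@innder F n be).
Proof.
move=> c al al'; rewrite /innder gamul_linearl gamul_linearr scalerBr.
by rewrite opprD addrACA.
Qed.

HB.instance Definition _ be :=
  GRing.isLinear.Build F (GA F n) (GA F n) _ (innder be) (innder_linear be).

Lemma dinnE be al : dinn be al = gamul al be - gamul be al.
Proof. by rewrite lfunE. Qed.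

Lemma dinn_linear : linear (@dinn F n).
Proof.
move=> c be be'; apply/lfunP => al; rewrite add_lfunE scale_lfunE !dinnE.
by rewrite gamul_linearl gamul_linearr scalerBr opprD addrACA.
Qed.

HB.instance Definition _ :=
  GRing.isLinear.Build F (GA F n) 'End(GA F n) _ (@dinn F n) dinn_linear.

(** The group elements span the algebra, so commuting with them is centrality; the identity be(xy) =
    be(yx) says that [be] is a class function. *)
Lemma dinn_eq0P be :
  dinn be = 0 <-> forall x y, be (sdmul x y) = be (sdmul y x).
Proof.
split=> [d0 x y | beC].
  have : dinn be (gael F y) = 0 by rewrite d0 lfunE.
  (* At the point yxy, the product y * be takes the value be(xy) and be * y takes the value
     be(yx). *)
  rewrite dinnE => /subr0_eq/ffunP/(_ (sdmul y (sdmul x y))).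
  rewrite [RHS]gamulEl [LHS]gamulEr.
  rewrite (bigD1 y) //= [X in _ + X]big1 => [|z /negPf zy]; last by rewrite ffunE zy mul0r.
  rewrite [RHS](bigD1 y) //= [X in _ = _ + X]big1 => [|z /negPf zy]; last first.
    by rewrite [gael _ _ _]ffunE zy mulr0.
  rewrite !ffunE eqxx mul1r mulr1 !addr0 sdmulA sdmulVg sdmul1g => ->.
  by rewrite -!sdmulA sdmulgV sdmulg1.
apply/lfunP => al; rewrite dinnE [RHS]lfunE; apply/eqP; rewrite subr_eq0.
apply/eqP/ffunP => x; rewrite [LHS]gamulEr [RHS]gamulEl.
by apply: eq_bigr => z _; rewrite mulrC beC.
Qed.

(** * Spans of group elements and a basis criterion *)

Lemma span_gaelP (s : seq (SD n)) (v : GA F n) :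
  reflect (forall x, x \notin s -> v x = 0) (v \in <<map (@gael F n) s>>%VS).
Proof.
apply: (iffP idP) => [vs x xs | v0].
  (* Evaluation at [x] is a linear form that kills every generator, hence the whole span. *)
  pose ev (w : GA F n) : F^o := w x.
  have ev_lin : linear ev by move=> c w w'; rewrite /ev !ffunE.
  pose evL : {linear GA F n -> F^o} := HB.pack ev (GRing.isLinear.Build _ _ _ _ _ ev_lin).
  suff /subvP/(_ v vs) : (<<map (@gael F n) s>> <= lker (linfun evL))%VS.
    by rewrite memv_ker lfunE /= /ev => /eqP.
  apply/span_subvP => _ /mapP[g gs ->]; rewrite memv_ker lfunE /= /ev ffunE.
  by case: (x =P g) xs gs => [-> /negPf->|].
have -> : v = \sum_(g | g \in s) v g *: gael F g.
  apply/ffunP => x; rewrite sum_ffunE; case: (boolP (x \in s)) => [xs | xs].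
    rewrite (bigD1 x) //= big1 => [|g /andP[_ /negPf gx]]; last first.
      by rewrite !ffunE eq_sym gx scaler0.
    by rewrite !ffunE eqxx addr0 [RHS]mulr1.
  rewrite v0 // big1 // => g gs; rewrite !ffunE.
  by case: eqP xs gs => [-> /negPf->|]; rewrite // scaler0.
by apply: memv_suml => g gs; rewrite memvZ // memv_span // map_f.
Qed.

Lemma free_gael (s : seq (SD n)) : uniq s -> free (map (@gael F n) s).
Proof.
elim: s => [|g s IHs] /=; first by rewrite nil_free.
move=> /andP[gs us]; rewrite free_cons IHs // andbT.
by apply/span_gaelP => /(_ g gs)/eqP; rewrite ffunE eqxx oner_eq0.
Qed.

(** Conjugate elements are exactly the pairs xy, yx, so the fourth hypothesis makes [rep] constant
    on conjugacy classes, and the fifth keeps [rep x] in the class of [x]. With the second and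
    third, [s] omits exactly [rep x] from that class. *)
Lemma basis_of_DerInn (s : seq (SD n)) (rep : SD n -> SD n) :
    uniq s -> (forall x, rep x \notin s) -> (forall x, x \notin s -> rep x = x) ->
    (forall x y, rep (sdmul x y) = rep (sdmul y x)) ->
    (forall x, exists g, sdmul g x = sdmul (rep x) g) ->
  basis_of (DerInn F n) [seq dinn (gael F g) | g <- s].
Proof.
move=> us rep_s s_rep repC rep_conj; pose D := linfun (@dinn F n).
pose U := <<map (@gael F n) s>>%VS.
have -> : [seq dinn (gael F g) | g <- s] = map D (map (@gael F n) s).
  by rewrite -map_comp; apply: eq_map => g /=; rewrite lfunE.
have -> : DerInn F n = (D @: U)%VS.
  apply: subv_anti; apply/andP; split; last by rewrite limgS ?subvf.
  apply/subvP => _ /memv_imgP[be _ ->]; rewrite lfunE /=.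
  pose z : GA F n := [ffun x => be (rep x)].
  have z0 : dinn z = 0 by apply/dinn_eq0P => x y; rewrite !ffunE repC.
  have -> : dinn be = D (be - z) by rewrite lfunE /= linearB /= z0 subr0.
  by apply/memv_img/span_gaelP => x /s_rep xs; rewrite !ffunE xs subrr.
apply: limg_basis_of; last by rewrite /basis_of eqxx free_gael.
(* It remains to see that [D] is injective on [U]: a class function [f] supported on [s] has f(x) =
   f(rep x) = 0. *)
apply/eqP; rewrite -subv0; apply/subvP => f; rewrite memv_cap memv_ker lfunE /=.
move=> /andP[/span_gaelP fs /eqP/dinn_eq0P fC]; rewrite memv0; apply/eqP/ffunP => x.
have [g xg] := rep_conj x; rewrite [RHS]ffunE -(fs _ (rep_s x)).
have <- : sdmul (sdmul g x) (sdinv g) = rep x by rewrite xg -sdmulA sdmulgV sdmulg1.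
by rewrite fC sdmulA sdmulVg sdmul1g.
Qed.

End SemiDihedral.

(** * Exponents modulo 4n and conjugation by b *)

Section Transversal.

Variables (n : nat) (n_gt0 : (0 < n)%N).
Implicit Types (x y : SD n) (i j : 'Z_(4 * n)) (k l : int).

Lemma ltn_Z i : (i < 4 * n)%N.
Proof. by case: i => v /=; rewrite Zp_cast //; lia. Qed.

Lemma val_natr (v : nat) : (v < 4 * n)%N -> (v%:R : 'Z_(4 * n)) = v :> nat.
Proof. by move=> ltv; rewrite val_Zp_nat ?modn_small //; lia. Qed.

Lemma val_intr k : - (4 * n%:Z) <= k < 4 * n%:Z ->
  (k%:~R : 'Z_(4 * n)) = `|(if 0 <= k then k else k + 4 * n%:Z)%R|%N :> nat.
Proof.
move=> rk; rewrite -[RHS]val_natr; last by case: ifP; lia.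
congr val; case: ifP => k0; first by rewrite -[in LHS](gez0_abs k0).
rewrite -[RHS]/(`|(k + 4 * n%:Z)%R|%N%:~R) gez0_abs; last lia.
by rewrite intrD intrM [X in _ = _ + X]four_n_eq0 // addr0.
Qed.

Lemma intr_inj k l : `|k - l| < 4 * n%:Z ->
  k%:~R = l%:~R :> 'Z_(4 * n) -> k = l.
Proof.
move=> kl /eqP; rewrite -subr_eq0 -intrB => /eqP/(congr1 val) /=.
by rewrite val_intr; [case: ifP|]; lia.
Qed.

(** Modulo 4n, i(2n-1) = 2ni - i is -i for even i and 2n - i for odd i; the branches choose the
    representative in [0, 4n). *)
Lemma val_conj i : (i * (2 * n - 1)%:R : 'Z_(4 * n)) =
  (if odd i then (if i <= 2 * n then 2 * n - i else 6 * n - i)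
   else if i == 0%N :> nat then 0 else 4 * n - i)%N :> nat.
Proof.
have lti := ltn_Z i; rewrite -[RHS]val_natr; last by case: ifP; case: ifP; lia.
congr val; rewrite sdexpE // -[i in LHS]natr_Zp; have n4 := four_n_eq0 n_gt0.
set v := nat_of_ord i in lti *; have := odd_double_half v; move: v./2 => w.
case: (odd v) => /= [vE|vE].
  transitivity (4 * n%:R * w%:R + 2 * n%:R - v%:R : 'Z_(4 * n)).
    by rewrite -vE natrD -muln2 natrM; ring.
  rewrite n4 mul0r add0r; case: ifP => vn; rewrite natrB ?natrM //; last lia.
  transitivity (4 * n%:R + 2 * n%:R - v%:R : 'Z_(4 * n)); last by ring.
  by rewrite n4 add0r.
transitivity (4 * n%:R * w%:R - v%:R : 'Z_(4 * n)).
  by rewrite -vE add0n -muln2 natrM; ring.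
rewrite n4 mul0r add0r; case: eqP => [->|v0]; first by rewrite oppr0.
by rewrite natrB ?natrM ?n4 ?sub0r //; lia.
Qed.

Lemma val_addZ (d : nat) i j : (d %| 4)%N -> ((i + j)%R = i + j %[mod d])%N.
Proof.
move=> d4; have -> : (i + j)%R = ((i + j) %% (4 * n))%N :> nat.
  by rewrite -val_Zp_nat ?natrD ?natr_Zp //; lia.
by rewrite modn_dvdm // dvdn_mulr.
Qed.

Lemma odd_addZ i j : odd (i + j)%R = odd i (+) odd j.
Proof. by have := @val_addZ 2 i j isT; rewrite !modn2 oddD; do 3!case: odd. Qed.

(* Common description of basis_even n and basis_odd n in terms of the
   representative of the exponent in [0, 4n). *)
Definition sdbasis x : bool :=
  if x.2 then (if odd n then 4 <= x.1 else 0 < x.1 < 4 * n - 1)%N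
  else (if odd x.1 then (x.1 < n) || (3 * n < x.1) else 0 < x.1 < 2 * n)%N.

(* The element of the conjugacy class of x that is not in sdbasis. *)
Definition sdrep x : SD n :=
  if x.2 then (if odd n then (x.1 %% 4)%N%:R else if odd x.1 then -1 else 0, true)
  else (if sdbasis x then x.1 * (2 * n - 1)%:R else x.1, false).

(** * Representatives of the conjugacy classes *)

Lemma val_N1 : (-1 : 'Z_(4 * n)) = (4 * n - 1)%N :> nat.
Proof. by rewrite -[-1]/((-1)%:~R) val_intr; [case: ifP|]; lia. Qed.

(** For rotations, conjugation by b sends even exponents in (0, 2n) into (2n, 4n), odd ones below n
    into (n, 2n), and odd ones above 3n into (2n, 3n). *)
Lemma sdrepN x : ~~ sdbasis (sdrep x).
Proof.
case: x => i [] /=; rewrite /sdrep /sdbasis /=.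
  case: (boolP (odd n)) => on; last by case: (odd i); rewrite ?val_N1 /=; lia.
  by rewrite val_natr; lia.
have lti := ltn_Z i.
case: (boolP (if odd i then _ else _)) => // bi; move: bi (val_conj i).
move: (nat_of_ord (i * _)) => c.
case: (boolP (odd i)) => oi; [case: (leqP i (2 * n))|case: eqP] => hi bi cE;
  by case: (boolP (odd c)) => oc; lia.
Qed.

Lemma sdrep_id x : ~~ sdbasis x -> sdrep x = x.
Proof.
case: x => i [] /=; rewrite /sdrep /sdbasis /=; last by case: (if odd i then _ else _).
have lti := ltn_Z i; case: (boolP (odd n)) => on h.
  by rewrite modn_small ?natr_Zp //; lia.
congr (_, _); apply: ord_inj; case: (boolP (odd i)) => oi; first by rewrite val_N1; lia.
by rewrite /=; lia.
Qed.

(** Conjugation by b is an involution on exponents. Each orbit of size two has exactly one member in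
    [sdbasis], and a fixed exponent is never there. *)
Lemma sdrep_conj i : sdrep (i, false) = sdrep (i * (2 * n - 1)%:R, false).
Proof.
have iss : i * (2 * n - 1)%:R * (2 * n - 1)%:R = i :> 'Z_(4 * n).
  transitivity (i + 4 * n%:R * (n%:R - 1) * i); first by rewrite sdexpE //; ring.
  by rewrite four_n_eq0 // !mul0r addr0.
have lti := ltn_Z i; have := val_conj i; move: iss.
have [c cd] : exists c : 'Z_(4 * n), c = i * (2 * n - 1)%:R by exists (i * (2 * n - 1)%:R).
rewrite -!cd => cs cE; rewrite /sdrep /sdbasis /= cs -cd; congr (_, _); apply: ord_inj.
move: cE; case: (boolP (odd i)) => oi; [case: (leqP i (2 * n))|case: eqP] => hi cE;
  by case: (boolP (odd c)) => oc; do 2!case: ifP => ?; lia.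
Qed.

Lemma sdrep_ab i :
  sdrep (i, true) = (if odd n then (i %% 4)%N%:R else if odd i then -1 else 0, true).
Proof. by []. Qed.

Lemma sdrepC x y : sdrep (sdmul x y) = sdrep (sdmul y x).
Proof.
(* The factor 2n-1 is odd, and it is 1 modulo 4 when n is odd, so it preserves the residue of [j] on
   which [sdrep] depends. *)
have refl i j : sdrep (i + j * (2 * n - 1)%:R, true) = sdrep (j + i, true).
  rewrite !sdrep_ab; have jE := val_conj j; have ltj := ltn_Z j; case: ifP => on.
    congr (_, _); congr (_%:R); rewrite !val_addZ // jE.
    by case: (boolP (odd j)) => oj; [case: (leqP j (2 * n))|case: eqP]; lia.
  rewrite !odd_addZ jE addbC; congr (if _ (+) _ then _ else _, _).
  by case: (boolP (odd j)) => oj; [case: (leqP j (2 * n))|case: eqP]; lia.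
case: x y => i [] [j []]; rewrite /sdmul /=.
(* The two products of a pair of reflections are rotations exchanged by conjugation by b, because
   (2n-1)^2 = 1. *)
- rewrite sdrep_conj mulrDl -mulrA addrC; congr (sdrep (_ + _, _)).
  transitivity (j + 4 * n%:R * (n%:R - 1) * j); first by rewrite sdexpE //; ring.
  by rewrite four_n_eq0 // !mul0r addr0.
- exact: refl.
- by rewrite refl.
- by rewrite addrC.
Qed.

Lemma sdrep_conjugate x : exists g, sdmul g x = sdmul (sdrep x) g.
Proof.
have n4 := four_n_eq0 n_gt0; case: x => i []; last first.
  rewrite /sdrep /=; case: ifP => _.
    by exists (0, true); rewrite /sdmul /= add0r addr0.
  by exists (0, false); rewrite /sdmul /= add0r addr0.
rewrite /sdrep /sdmul /=.
have vE : i = (i : nat)%:R by rewrite natr_Zp.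
case: ifP => on.
  (* Conjugating by a^t replaces the exponent i by i - t(2n-2). With i = 4q + r, the choice t = -2q
     yields r modulo 4n. *)
  exists (- 2 * (i %/ 4)%N%:R, false); cbn [fst snd]; congr (_, _).
  rewrite sdexpE // [X in _ + X]vE [X in _ + X%:R](divn_eq i 4) natrD natrM.
  transitivity ((i %% 4)%N%:R + - 2 * (i %/ 4)%N%:R * (2 * n%:R - 1)
                 + 4 * n%:R * (i %/ 4)%N%:R : 'Z_(4 * n)); first by ring.
  by rewrite n4 mul0r addr0.
have [m nE] : exists m, n = (2 * m)%N by exists n./2; lia.
have nm : n%:R = 2 * m%:R :> 'Z_(4 * n) by rewrite -natrM; congr _%:R.
(* Now i = 2u - o with [o] the parity of [i], and t = (n-1)u leaves -o: as n is even, 2(n-1)^2 = 2 +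
   2n(n-2) is 2 modulo 4n. *)
exists ((n%:R - 1) * (uphalf i)%:R, false); cbn [fst snd]; congr (_, _).
have iE : i = 2 * (uphalf i)%:R - (odd i)%:R :> 'Z_(4 * n).
  by rewrite [LHS]vE -natrM -natrB; [congr _%:R|]; lia.
rewrite sdexpE // [X in _ + X = _]iE; move: (uphalf i) (odd i) => u o.
transitivity ((if o then -1 else 0) + (n%:R - 1) * u%:R * (2 * n%:R - 1)
              + 4 * n%:R * (u%:R * (1 - m%:R)) : 'Z_(4 * n)).
  by rewrite nm; case: o => /=; ring.
by rewrite n4 mul0r addr0.
Qed.


(** * The listed sets and their cardinalities *)

Lemma val_intrP k (v := nat_of_ord (k%:~R : 'Z_(4 * n))) :
  - (4 * n%:Z) <= k < 4 * n%:Z ->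
  0 <= k /\ v%:Z = k \/ k < 0 /\ v%:Z = k + 4 * n%:Z.
Proof. by move=> rk; rewrite /v val_intr //; case: ifP; lia. Qed.

Lemma eq_intr i k : i%:Z = k \/ i%:Z = k + 4 * n%:Z -> i = k%:~R.
Proof.
case=> [<-|iE]; first by rewrite -[LHS]natr_Zp.
have -> : k = i%:Z - 4 * n%:Z by rewrite iE addrK.
by rewrite intrB intrM [X in _ - X]four_n_eq0 // subr0 -[LHS]natr_Zp.
Qed.

(** One formula serves both parities: for odd n, [n./2] equals [(n - 1)./2] and [n - odd n] is n -
    1. *)
Definition rotations : seq (SD n) :=
  [seq sda n (2 * k%:Z) | k : nat <- iota 1 (n - 1)] ++
  [seq sda n (2 * (i%:Z - (n./2)%:Z) + 1) | i : nat <- iota 0 (n - odd n)].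

Lemma mem_rotations i e : ((i, e) \in rotations) = ~~ e && sdbasis (i, e).
Proof.
rewrite mem_cat; apply/idP/idP.
  case/orP => /mapP[k]; rewrite mem_iota => rk [-> ->]; rewrite /sdbasis /fst /snd.
    have /val_intrP : - (4 * n%:Z) <= 2 * k%:Z < 4 * n%:Z by lia.
    by move: (nat_of_ord _) => v; case: (boolP (odd v)); lia.
  have /val_intrP : - (4 * n%:Z) <= 2 * (k%:Z - (n./2)%:Z) + 1 < 4 * n%:Z by lia.
  by move: (nat_of_ord _) => v; case: (boolP (odd v)); lia.
case: e => //; rewrite /sdbasis /=; have lti := ltn_Z i.
case: (boolP (odd i)) => oi ri; apply/orP.
  right; apply/mapP; case: (ltnP i n) => ltin.
    exists ((i - 1)./2 + n./2)%N; first by rewrite mem_iota; lia.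
    by congr (_, _); apply: eq_intr; lia.
  (* An exponent above 3n is listed as the negative integer i - 4n. *)
  exists (n./2 - (4 * n + 1 - i)./2)%N; first by rewrite mem_iota; lia.
  by congr (_, _); apply: eq_intr; lia.
left; apply/mapP; exists i./2; first by rewrite mem_iota; lia.
by congr (_, _); apply: eq_intr; lia.
Qed.

Lemma uniq_rotations : uniq rotations.
Proof.
rewrite cat_uniq !map_inj_in_uniq ?iota_uniq /= ?andbT.
- apply/hasPn => _ /mapP[k rk ->]; apply/mapP => -[l rl [/intr_inj]].
  by move: rk rl; rewrite !mem_iota; lia.
- move=> k l; rewrite !mem_iota => rk rl [/intr_inj]; lia.
- move=> k l; rewrite !mem_iota => rk rl [/intr_inj]; lia.
Qed.

Lemma size_rotations : size rotations = (n - 1 + (n - odd n))%N.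
Proof. by rewrite size_cat !size_map !size_iota. Qed.

(** Indexing by pairs (k, t) gives access to the general facts on membership, uniqueness and size of
    [allpairs]. *)
Definition reflections_even : seq (SD n) :=
  [seq sdab n (2 * k%:Z - t%:Z) | k : nat <- iota 1 (2 * n - 1), t : nat <- iota 0 2].

Definition reflections_odd : seq (SD n) :=
  [seq sdab n (4 * k%:Z + t%:Z) | k : nat <- iota 1 (n - 1), t : nat <- iota 0 4].

Lemma basis_evenE : ~~ odd n -> basis_even n = rotations ++ reflections_even.
Proof.
move=> /negPf on; rewrite /basis_even /rotations on subn0 catA; congr (_ ++ flatten _).
by apply: eq_map => k /=; rewrite subr0.
Qed.

Lemma basis_oddE : odd n -> basis_odd n = rotations ++ reflections_odd.
Proof.
move=> on; rewrite /basis_odd /rotations on catA; have -> : (n - 1)./2 = n./2 by lia.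
by congr (_ ++ flatten _); apply: eq_map => k /=; rewrite addr0.
Qed.

Lemma mem_reflections_even i e : ~~ odd n ->
  ((i, e) \in reflections_even) = e && sdbasis (i, e).
Proof.
move=> on; apply/allpairsP/idP => [[[k t]] | ].
  rewrite !mem_iota /= => -[rk rt [-> ->]].
  have /val_intrP : - (4 * n%:Z) <= 2 * k%:Z - t%:Z < 4 * n%:Z by lia.
  by rewrite /sdbasis /fst /snd (negPf on); move: (nat_of_ord _) => v; lia.
case: e => //; rewrite /sdbasis /= (negPf on) => ri.
(* The offset is subtracted, so [i] is rounded up to an even number: i = 2 * uphalf i - odd i. *)
exists (uphalf i, odd i : nat); split => /=; first by rewrite mem_iota; lia.
  by case: (odd i).
by congr (_, _); apply: eq_intr; lia.
Qed.

Lemma mem_reflections_odd i e : odd n ->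
  ((i, e) \in reflections_odd) = e && sdbasis (i, e).
Proof.
move=> on; apply/allpairsP/idP => [[[k t]] | ].
  rewrite !mem_iota /= => -[rk rt [-> ->]].
  have /val_intrP : - (4 * n%:Z) <= 4 * k%:Z + t%:Z < 4 * n%:Z by lia.
  by rewrite /sdbasis /fst /snd on; move: (nat_of_ord _) => v; lia.
case: e => //; rewrite /sdbasis /= on => ri; have lti := ltn_Z i.
exists (i %/ 4, i %% 4)%N; split; first by rewrite mem_iota /=; lia.
  by rewrite (mem_iota 0 4) /=; lia.
by cbn [fst snd]; congr (_, _); apply: eq_intr; lia.
Qed.

Lemma uniq_reflections_even : uniq reflections_even.
Proof.
apply: allpairs_uniq; rewrite ?iota_uniq // => -[k t] [l u].
move=> /allpairsP[[k' t'] [+ + [-> ->]]] /allpairsP[[l' u'] [+ + [-> ->]]].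
rewrite !mem_iota /= => rk rt rl ru [/intr_inj klE].
by congr (_, _); lia.
Qed.

Lemma uniq_reflections_odd : uniq reflections_odd.
Proof.
apply: allpairs_uniq; rewrite ?iota_uniq // => -[k t] [l u].
move=> /allpairsP[[k' t'] [+ + [-> ->]]] /allpairsP[[l' u'] [+ + [-> ->]]].
rewrite !mem_iota /= => rk rt rl ru [/intr_inj klE].
by congr (_, _); lia.
Qed.

Lemma mem_basis_even x : ~~ odd n -> (x \in basis_even n) = sdbasis x.
Proof.
case: x => i e on; rewrite basis_evenE // mem_cat mem_rotations mem_reflections_even //.
by case: e; rewrite ?orbF.
Qed.

Lemma mem_basis_odd x : odd n -> (x \in basis_odd n) = sdbasis x.
Proof.
case: x => i e on; rewrite basis_oddE // mem_cat mem_rotations mem_reflections_odd //.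
by case: e; rewrite ?orbF.
Qed.

Lemma uniq_basis_even : ~~ odd n -> uniq (basis_even n).
Proof.
move=> on; rewrite basis_evenE // cat_uniq uniq_rotations uniq_reflections_even andbT.
apply/hasPn => -[i e]; rewrite mem_reflections_even //= mem_rotations.
by case: e.
Qed.

Lemma uniq_basis_odd : odd n -> uniq (basis_odd n).
Proof.
move=> on; rewrite basis_oddE // cat_uniq uniq_rotations uniq_reflections_odd andbT.
apply/hasPn => -[i e]; rewrite mem_reflections_odd //= mem_rotations.
by case: e.
Qed.

Lemma size_basis_even : ~~ odd n -> size (basis_even n) = (3 * (2 * n - 1))%N.
Proof.
by move=> on; rewrite basis_evenE // size_cat size_rotations size_allpairs !size_iota; lia.
Qed.

Lemma size_basis_odd : odd n -> size (basis_odd n) = (6 * (n - 1))%N.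
Proof.
by move=> on; rewrite basis_oddE // size_cat size_rotations size_allpairs !size_iota; lia.
Qed.

(** * The bases and the dimension *)

Lemma basis_of_DerInn_sdbasis (F : fieldType) (s : seq (SD n)) :
  uniq s -> s =i sdbasis -> basis_of (DerInn F n) [seq dinn (gael F g) | g <- s].
Proof.
move=> us sE; apply: (basis_of_DerInn n_gt0 F us _ _ sdrepC sdrep_conjugate) => x.
  by rewrite sE; apply: sdrepN.
by rewrite sE; apply: sdrep_id.
Qed.

End Transversal.

Theorem theorem5p5 (F : fieldType) (n : nat) (hn : (1 <= n)%N) :
  \dim (DerInn F n) = (if odd n then 6 * (n - 1) else 3 * (2 * n - 1))%N /\
  (~~ odd n -> basis_of (DerInn F n) [seq dinn (gael F g) | g <- basis_even n]) /\
  (odd n -> basis_of (DerInn F n) [seq dinn (gael F g) | g <- basis_odd n]).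
Proof.
have Be : ~~ odd n -> basis_of (DerInn F n) [seq dinn (gael F g) | g <- basis_even n].
  move=> on; apply: basis_of_DerInn_sdbasis (uniq_basis_even hn on) _ => // x.
  exact: mem_basis_even.
have Bo : odd n -> basis_of (DerInn F n) [seq dinn (gael F g) | g <- basis_odd n].
  move=> on; apply: basis_of_DerInn_sdbasis (uniq_basis_odd hn on) _ => // x.
  exact: mem_basis_odd.
split=> //; case: (boolP (odd n)) => on.
  by rewrite (size_basis (Bo on : basis_of _ (in_tuple _))) size_map size_basis_odd.
by rewrite (size_basis (Be on : basis_of _ (in_tuple _))) size_map size_basis_even.
Qed.
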